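(* Let $m\ge 2$ and let $G_{m,4}=S_m\Box P_4$ be the stacked-book graph. Then $im(G_{m,4})=m$.
   Context: $S_m$ is the star graph with one central vertex and $m-1$ leaves ($m$ vertices in total); $P_n$ is the path on $n$ vertices. The stacked-book graph $G_{m,n}=S_m\Box P_n$ consists of $n$ copies $S_m(1),\dots,S_m(n)$ of $S_m$, with each vertex of $S_m(i)$ joined to the corresponding vertex of $S_m(i+1)$ for $i\in[1,n-1]$. An induced matching of a graph $G$ is a set $M$ of edges such that no two edges of $M$ share an endpoint and no edge of $G$ joins an endpoint of one edge of $M$ to an endpoint of another edge of $M$; $im(G)$ is the maximum size of an induced matching of $G$. *)

(* Defs.v *)
From mathcomp Require Import all_boot.

Set Implicit Arguments.
Unset Strict Implicit.
Unset Printing Implicit Defensive.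

(* A finite simple graph. *)
Record sgraph := SGraph {
  vertex :> finType;
  adj : rel vertex;
  adj_sym : symmetric adj;
  adj_irr : irreflexive adj
}.

(* Edges are unordered pairs, encoded as two-element vertex sets. *)
Definition edges (G : sgraph) : {set {set G}} :=
  [set [set p.1; p.2] | p : G * G & adj p.1 p.2].

(* The center is the vertex of value 0; the other m - 1 ordinals are leaves. *)
Definition star_adj (m : nat) : rel 'I_m :=
  fun i j => (i != j) && ((i == 0 :> nat) || (j == 0 :> nat)).

Lemma star_sym (m : nat) : symmetric (@star_adj m).
Proof. by move=> i j; rewrite /star_adj eq_sym orbC. Qed.

Lemma star_irr (m : nat) : irreflexive (@star_adj m).
Proof. by move=> i; rewrite /star_adj eqxx. Qed.

Definition star (m : nat) : sgraph := SGraph (@star_sym m) (@star_irr m).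

Definition path_adj (n : nat) : rel 'I_n :=
  fun i j => (i.+1 == j :> nat) || (j.+1 == i :> nat).

Lemma path_sym (n : nat) : symmetric (@path_adj n).
Proof. by move=> i j; rewrite /path_adj orbC. Qed.

Lemma path_irr (n : nat) : irreflexive (@path_adj n).
Proof. by move=> i; rewrite /path_adj orbb gtn_eqF. Qed.

Definition path_graph (n : nat) : sgraph := SGraph (@path_sym n) (@path_irr n).

Definition box_adj (G H : sgraph) : rel (G * H) :=
  fun u v => ((u.1 == v.1) && adj u.2 v.2) || ((u.2 == v.2) && adj u.1 v.1).

Lemma box_sym (G H : sgraph) : symmetric (@box_adj G H).
Proof.
move=> u v; rewrite /box_adj (eq_sym u.1) (eq_sym u.2).
by rewrite (adj_sym u.1) (adj_sym u.2).
Qed.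

Lemma box_irr (G H : sgraph) : irreflexive (@box_adj G H).
Proof. by move=> u; rewrite /box_adj !adj_irr !andbF. Qed.

Definition box (G H : sgraph) : sgraph := SGraph (@box_sym G H) (@box_irr G H).

Definition stacked_book (m n : nat) : sgraph := box (star m) (path_graph n).

Definition induced_matching (G : sgraph) (M : {set {set G}}) : bool :=
  (M \subset edges G) &&
  [forall e in M, forall f in M, (e != f) ==>
     [disjoint e & f] && [forall x in e, forall y in f, ~~ adj x y]].

Definition im (G : sgraph) : nat :=
  \max_(M : {set {set G}} | induced_matching M) #|M|.

(* Main.v *)
Require Import Defs.
From mathcomp Require Import all_boot.
From mathcomp Require Import zify.

(** For the lower bound take the edge between layers 0 and 1 over every leaf,
    and the edge between layers 2 and 3 over the center.

    For the upper bound call the copy of [P_4] over a vertex of the star a fiber,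
    and let [M] be an induced matching.  Any two edges of [P_4] are joined by an
    edge or share a vertex, so each leaf fiber contains at most one edge of [M].
    At most one edge of [M] meets the center fiber in layers 0-1, and at most one
    in layers 2-3.  If both exist, some leaf fiber contains no edge of [M]: an
    edge of [M] over a leaf must avoid both layers used by the center, which
    forces it to join layers 1 and 2 and the center edges to be rungs in layers
    0 and 3; then the fiber of the leaf end of a rung contains no edge of [M]. *)

Lemma edgesP (G : sgraph) (e : {set G}) :
  reflect (exists u v : G, adj u v /\ e = [set u; v]) (e \in edges G).
Proof.
apply: (iffP imsetP) => [[[u v]]|[u [v [uv ->]]]]; last by exists (u, v); rewrite ?inE.
by rewrite inE => uv ->; exists u, v.
Qed.

Lemma induced_matching_eq {G : sgraph} {M : {set {set G}}} :
  induced_matching M -> forall e f u v, e \in M -> f \in M ->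
  u \in e -> v \in f -> (u == v) || adj u v -> e = f.
Proof.
case/andP=> _ /forall_inP Mi e f u v eM fM ue vf uv.
apply/eqP/negPn/negP => nef.
have /implyP/(_ nef)/andP[dis /forall_inP na] :=
  forall_inP (Mi e eM) f fM.
case/orP: uv => [/eqP uv|uv].
  by rewrite uv (disjointFl dis vf) in ue.
by have /forall_inP/(_ v vf) := na u ue; rewrite uv.
Qed.

(** Meant for center edges in layers [i], [j] and a leaf edge on [k], [k']: among pairs at distance
    at least two, only 0 and 3 leave two consecutive layers free. *)
Lemma avoided_layers (i j k k' : nat) :
  i < 2 -> i.+1 < j -> j < 4 -> k' = k.+1 -> k' < 4 ->
  i != k -> i != k' -> j != k -> j != k' -> i = 0 /\ k = 1.
Proof.
case: i => [|[|i]] //; case: j => [|[|[|[|j]]]] //;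
by case: k => [|[|[|k]]] // _ _ _ ->.
Qed.

Section BookOfLengthFour.

Variable m : nat.
Notation G := (stacked_book m.+1 4).

Lemma book_adjE (a b : 'I_m.+1) (i j : 'I_4) :
  adj ((a, i) : G) ((b, j) : G) =
  (a == b) && ((i.+1 == j) || (j.+1 == i)) ||
  (i == j) && ((a != b) && ((a == ord0) || (b == ord0))).
Proof. by []. Qed.

Definition meets_fiber (e : {set G}) (a : 'I_m.+1) : bool :=
  [exists i : 'I_4, ((a, i) : G) \in e].

(** The default [ord0] serves only the empty set; a leaf edge lies in one fiber, so there the choice
    is forced. *)
Definition fiber_of (e : {set G}) : 'I_m.+1 := odflt ord0 [pick a | meets_fiber e a].

Section UpperBound.

Variable M : {set {set G}}.
Hypothesis M_ind : induced_matching M.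

Definition center_edges : {set {set G}} := [set e in M | meets_fiber e ord0].
Definition leaf_edges : {set {set G}} := M :\: center_edges.

(** Layers differing by at most one give equal or adjacent vertices of the fiber. *)
Lemma same_fiber_eq (e f : {set G}) (a : 'I_m.+1) (i j : 'I_4) :
  e \in M -> f \in M -> ((a, i) : G) \in e -> ((a, j) : G) \in f ->
  i <= j.+1 -> j <= i.+1 -> e = f.
Proof.
move=> eM fM ie jf ij ji; apply: (induced_matching_eq M_ind _ _ _ _ eM fM ie jf).
rewrite book_adjE eqxx /= xpair_eqE eqxx /= -val_eqE /=; lia.
Qed.

(** Within a layer the center is adjacent to every other vertex. *)
Lemma center_layer_eq (e f : {set G}) (a : 'I_m.+1) (i : 'I_4) :
  e \in M -> f \in M -> ((ord0, i) : G) \in e -> ((a, i) : G) \in f -> e = f.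
Proof.
move=> eM fM ie jf; apply: (induced_matching_eq M_ind _ _ _ _ eM fM ie jf).
rewrite book_adjE xpair_eqE !eqxx /= andbT.
by case: eqP.
Qed.

(** Every rung has a center end, so an edge missing the center fiber stays over one leaf. *)
Lemma leaf_edge_layers (e : {set G}) : e \in leaf_edges ->
  [/\ e \in M, fiber_of e != ord0 & exists i j : 'I_4,
      [/\ j = i.+1 :> nat, ((fiber_of e, i) : G) \in e
        & ((fiber_of e, j) : G) \in e]].
Proof.
rewrite !inE => /andP[+ eM]; rewrite eM /= => n0.
have /edgesP[[a i] [[b j] [adjuv def_e]]] := subsetP (proj1 (andP M_ind)) e eM.
have ie : ((a, i) : G) \in e by rewrite def_e !inE eqxx.
have je : ((b, j) : G) \in e by rewrite def_e !inE eqxx orbT.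
have an0 : a != ord0.
  by apply: contraNneq n0 => <-; apply/existsP; exists i.
have bn0 : b != ord0.
  by apply: contraNneq n0 => <-; apply/existsP; exists j.
move: adjuv; rewrite book_adjE (negPf an0) (negPf bn0) /= !andbF orbF.
case/andP=> /eqP ab ij; rewrite -{b bn0}ab in je def_e.
have -> : fiber_of e = a.
  rewrite /fiber_of; case: pickP => [c /existsP[k]|/(_ a)/existsP[]]; last by exists i.
  by rewrite def_e !inE => /orP[] /eqP[->].
split=> //; case/orP: ij => /eqP ij; first by exists i, j.
by exists j, i.
Qed.

Lemma fiber_of_inj : {in leaf_edges &, injective fiber_of}.
Proof.
move=> e f /leaf_edge_layers[eM _ [i [i' [ii' ie i'e]]]].
move=> /leaf_edge_layers[fM _ [j [j' [jj' jf j'f]]]] ef.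
rewrite -{}ef in jf j'f.
(* Lower ends are in layers at most 2, so the upper end of the lower edge is within one layer of the
   lower end of the other. *)
have [le|lt] := leqP i j.
  by apply: (same_fiber_eq _ _ _ _ _ eM fM i'e jf); move: (ltn_ord j'); lia.
by apply: (same_fiber_eq _ _ _ _ _ eM fM ie j'f); move: (ltn_ord i'); lia.
Qed.

(** An edge joining center layers 1 and 2 counts as low. *)
Definition low_center (e : {set G}) : bool :=
  [exists i : 'I_4, (((ord0, i) : G) \in e) && (i < 2)].

Lemma center_edge_layer (e : {set G}) : e \in center_edges ->
  e \in M /\ exists2 i : 'I_4, ((ord0, i) : G) \in e & (i < 2) = low_center e.
Proof.
rewrite inE => /andP[eM /existsP[i ie]]; split=> //.
have [/existsP[j /andP[je j2]]|nl] := boolP (low_center e); first by exists j.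
exists i => //; apply: contraNF nl => i2.
by apply/existsP; exists i; rewrite ie.
Qed.

(** Two layers in the same half of [P_4] are equal or consecutive. *)
Lemma low_center_inj : {in center_edges &, injective low_center}.
Proof.
move=> e f /center_edge_layer[eM [i ie li]] /center_edge_layer[fM [j jf lj]] ef.
rewrite -{}ef -{}li in lj.
by apply: (same_fiber_eq _ _ _ _ _ eM fM ie jf); move: (ltn_ord i) (ltn_ord j); lia.
Qed.

Lemma card_center_edges : #|center_edges| <= 2.
Proof.
rewrite -(card_in_imset low_center_inj).
by apply: leq_trans (max_card _) _; rewrite card_bool.
Qed.

Lemma free_leaf : 0 < m -> 1 < #|center_edges| ->
  exists2 a : 'I_m.+1, a != ord0 & a \notin fiber_of @: leaf_edges.
Proof.
move=> m_gt0 /card_gt1P[e [f [eC fC nef]]].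
wlog le : e f eC fC nef / low_center e.
  move=> wlg; have [le|nle] := boolP (low_center e); first exact: (wlg e f).
  apply: (wlg f e) => //; first by rewrite eq_sym.
  apply: contraR nef => nlf; apply/eqP; apply: low_center_inj => //.
  by rewrite (negPf nle) (negPf nlf).
have [eM [i ie]] := center_edge_layer _ eC; rewrite le => i2.
have [fM [j jf _]] := center_edge_layer _ fC.
(* Distinct edges need layers at distance at least two, and [i <= 1] leaves room only above [i]. *)
have ij : i.+1 < j.
  rewrite ltnNge; apply: contra nef => ji; apply/eqP.
  apply: (same_fiber_eq _ _ _ _ _ eM fM ie jf _ ji); exact: leq_trans (i2 : i <= 1) _.
have leaf_neq g h : g \in leaf_edges -> h \in center_edges -> h <> g.
  by rewrite inE => /andP[gC _] hC hg; rewrite -hg hC in gC.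
(* A leaf edge avoids layers [i < 2] and [j > i + 1], hence joins layers 1 and 2. *)
have leaf_mid g : g \in leaf_edges ->
    i = 0 :> nat /\ exists2 k : 'I_4, k = 1 :> nat & ((fiber_of g, k) : G) \in g.
  move=> gF; have [gM _ [k [k' [kk' kg k'g]]]] := leaf_edge_layers _ gF.
  have avoid (h : {set G}) (l l' : 'I_4) : h \in center_edges -> h \in M ->
      ((ord0, l) : G) \in h -> ((fiber_of g, l') : G) \in g -> l != l' :> nat.
    move=> hC hM lh lg; apply/eqP => /val_inj ll'; rewrite -ll' in lg.
    exact: (leaf_neq g h gF hC (center_layer_eq _ _ _ _ hM gM lh lg)).
  have := (avoid e i k eC eM ie kg, avoid e i k' eC eM ie k'g,
           avoid f j k fC fM jf kg, avoid f j k' fC fM jf k'g).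
  case=> [[[ik ik'] jk] jk'].
  have [i0 k1] : i = 0 :> nat /\ k = 1 :> nat.
    exact: (avoided_layers i j k k' i2 ij (ltn_ord j) kk' (ltn_ord k')).
  by split=> //; exists k.
(* Without leaf edges every leaf is free, and leaf 1 exists as [0 < m]. *)
have [F0|[g gF]] := set_0Vmem leaf_edges.
  by exists (inord 1); rewrite ?F0 ?imset0 ?inE // -val_eqE /= inordK.
have [i0 [k k1 kg]] := leaf_mid g gF.
have gM : g \in M by case: (leaf_edge_layers _ gF).
(* The center end of [e] is in layer 0. Its other end cannot be the center in layer 1, which is
   adjacent to an end of [g], so [e] is a rung. *)
have [a an0 ae] : exists2 a : 'I_m.+1, a != ord0 & ((a, i) : G) \in e.
  have /edgesP[[a l] [[b l'] [adjuv def_e]]] := subsetP (proj1 (andP M_ind)) e eM.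
  have le' : ((a, l) : G) \in e by rewrite def_e !inE eqxx.
  have l'e : ((b, l') : G) \in e by rewrite def_e !inE eqxx orbT.
  have no1 (h : 'I_4) : ((ord0, h) : G) \in e -> h != 1 :> nat.
    move=> he; apply/eqP => h1; have hk : h = k by apply: val_inj; rewrite /= h1 k1.
    rewrite hk in he.
    exact: (leaf_neq g e gF eC (center_layer_eq _ _ _ _ eM gM he kg)).
  move: ie; rewrite {1}def_e !inE !xpair_eqE => /orP[] /andP[/eqP a0 /eqP il].
    rewrite -a0 -il in le' adjuv; move: adjuv; rewrite book_adjE i0 /= orbF.
    case/orP=> [/andP[/eqP b0 /eqP l1]|/and3P[/eqP il' b0 _]].
      by rewrite -b0 in l'e; move: (no1 _ l'e); rewrite -l1.
    by exists b; rewrite 1?eq_sym // il'.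
  rewrite -a0 -il in l'e adjuv; move: adjuv; rewrite book_adjE i0 /=.
  case/orP=> [/andP[/eqP b0 /eqP l1]|/and3P[/eqP il' b0 _]].
    by rewrite b0 in le'; move: (no1 _ le'); rewrite -l1.
  by exists a; rewrite // -il'.
(* A leaf edge over [a] would have an end in layer 1, adjacent to the leaf end of [e] in layer 0. *)
exists a => //; apply/imsetP => -[h hF ah].
have [_ [k' k'1 k'h]] := leaf_mid h hF; rewrite -ah in k'h.
have hM : h \in M by case: (leaf_edge_layers _ hF).
by apply: (leaf_neq h e hF eC); apply: (same_fiber_eq _ _ _ _ _ eM hM ae k'h);
  rewrite i0 k'1.
Qed.

(** The count is at most [1 + m], or [2 + (m - 1)] when a second center edge costs a leaf. *)
Lemma card_induced_matching_book : 0 < m -> #|M| <= m.+1.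
Proof.
move=> m_gt0.
have -> : #|M| = #|center_edges| + #|leaf_edges|.
  rewrite -(cardsID center_edges M); congr (#|pred_of_set _| + _).
  by apply/setIidPr/subsetP => e; rewrite inE => /andP[].
rewrite -(card_in_imset fiber_of_inj).
have sF : fiber_of @: leaf_edges \subset [set~ ord0].
  by apply/subsetP => _ /imsetP[e /leaf_edge_layers[_ ? _] ->]; rewrite !inE.
have [C1|C2] := leqP #|center_edges| 1.
  by apply: (@leq_add _ _ 1 m) => //; have := subset_leq_card sF; rewrite cardsC1 card_ord.
have [a an0 aF] := free_leaf m_gt0 C2.
have : fiber_of @: leaf_edges \subset [set~ ord0] :\ a by rewrite subsetD1 sF.
move/subset_leq_card => leF; have := cardsD1 a [set~ ord0].
rewrite cardsC1 card_ord !inE an0 add1n /= => m_def.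
by apply: leq_trans (leq_add card_center_edges leF) _; rewrite add2n -m_def.
Qed.

End UpperBound.

Definition low_layer (a : 'I_m.+1) : 'I_4 := inord (if a == ord0 then 2 else 0).
Definition high_layer (a : 'I_m.+1) : 'I_4 := inord (if a == ord0 then 3 else 1).
Definition fiber_edge (a : 'I_m.+1) : {set G} :=
  [set ((a, low_layer a) : G); ((a, high_layer a) : G)].

Lemma in_fiber_edge (a b : 'I_m.+1) (i : 'I_4) :
  ((b, i) : G) \in fiber_edge a -> b = a /\ (2 <= i) = (a == ord0).
Proof.
rewrite !inE !xpair_eqE => /orP[] /andP[/eqP-> /eqP->]; split=> //;
  by rewrite inordK; case: (a == ord0).
Qed.

Lemma fiber_edge_inj : injective fiber_edge.
Proof.
move=> a b ab.
have : ((a, low_layer a) : G) \in fiber_edge b by rewrite -ab !inE eqxx.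
by case/in_fiber_edge.
Qed.

Lemma fiber_edges_induced_matching : induced_matching [set fiber_edge a | a : 'I_m.+1].
Proof.
apply/andP; split.
  apply/subsetP => _ /imsetP[a _ ->]; apply/edgesP.
  exists (a, low_layer a), (a, high_layer a); split=> //.
  by rewrite book_adjE eqxx /= !inordK; case: (a == ord0).
apply/forall_inP => _ /imsetP[a _ ->]; apply/forall_inP => _ /imsetP[b _ ->].
apply/implyP => nab; have {}nab : a != b by apply: contraNneq nab => ->.
apply/andP; split.
  rewrite disjoint_subset; apply/subsetP => -[c i] /in_fiber_edge[-> _].
  rewrite inE; apply/negP => /in_fiber_edge[ab _].
  by rewrite ab eqxx in nab.
apply/forall_inP => -[c i] /in_fiber_edge[-> la].
apply/forall_inP => -[d j] /in_fiber_edge[-> lb].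
(* Adjacency across fibers needs a common layer and the center, but the center edge shares no layer
   with the leaf edges. *)
rewrite book_adjE (negPf nab) /=; apply/negP => /andP[/eqP ij ab0].
rewrite ij lb in la; case/orP: ab0 => /eqP z.
  by move: la nab; rewrite z eqxx => /eqP ->; rewrite eqxx.
by move: la nab; rewrite z eqxx => /esym/eqP ->; rewrite eqxx.
Qed.

End BookOfLengthFour.

Theorem theorem7 (m : nat) (hm : 2 <= m) : im (stacked_book m 4) = m.
Proof.
case: m hm => // m hm; apply/eqP; rewrite eqn_leq; apply/andP; split.
  by apply/bigmax_leqP => M M_ind; apply: card_induced_matching_book.
apply: leq_trans (leq_bigmax_cond _ (fiber_edges_induced_matching m)).
by rewrite card_imset ?card_ord //; apply: fiber_edge_inj.
Qed.
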